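(* Let $\mathcal{G}=(\mathcal{V},\mathcal{E})$ be a connected undirected graph with vertex set $\mathcal{V}=\{1,\ldots,n\}$, and let $N$ be the number of orbits of $\mathcal{E}$ under the action of $\mathrm{Aut}(\mathcal{G})$. Then the number of distinct edge transition probabilities one needs to consider in the fastest mixing Markov chain (FMMC) problem on $\mathcal{G}$ is at most $N$; that is, the FMMC problem has an optimal solution $P$ for which the set of edge transition probabilities $\{P_{ij} : \{i,j\}\in\mathcal{E}\}$ has at most $N$ elements.
   Context: The graph is finite and simple. The feasible set of the FMMC problem is $$\mathcal{C}=\{P\in\mathbb{R}^{n\times n} : P\ge 0 \text{ (elementwise)},\ P\mathbf{1}=\mathbf{1},\ P=P^T,\ P_{ij}=0 \text{ for } i\neq j,\ \{i,j\}\notin\mathcal{E}\},$$ where $\mathbf{1}$ is the all-ones vector. For $P\in\mathcal{C}$ with eigenvalues $1=\lambda_1(P)\ge\cdots\ge\lambda_n(P)\ge -1$, let $\mu(P)=\max_{i=2,\ldots,n}|\lambda_i(P)|$, equivalently $\mu(P)=\|P-(1/n)\mathbf{1}\mathbf{1}^T\|_2$ (spectral norm). The FMMC problem is to minimize $\mu(P)$ over $P\in\mathcal{C}$; an optimal solution is a minimizer. $\mathrm{Aut}(\mathcal{G})$ is the group of permutations $\sigma$ of $\mathcal{V}$ with $\{i,j\}\in\mathcal{E}$ if and only if $\{\sigma(i),\sigma(j)\}\in\mathcal{E}$; it acts on $\mathcal{E}$ by $\sigma(\{i,j\})=\{\sigma(i),\sigma(j)\}$. *)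

(* Defs.v *)
From mathcomp Require Import all_boot all_order all_algebra all_fingroup.
From mathcomp Require Import reals polyrcf.

Set Implicit Arguments.
Unset Strict Implicit.
Unset Printing Implicit Defensive.

Import Order.TTheory GRing.Theory Num.Theory.
Local Open Scope ring_scope.

(* A finite simple graph is given by its adjacency relation
   [e : rel 'I_n], assumed symmetric and irreflexive in the theorem. *)

Definition edges (n : nat) (e : rel 'I_n) : {set {set 'I_n}} :=
  [set [set p.1; p.2] | p : 'I_n * 'I_n & e p.1 p.2].

Definition connected_graph (n : nat) (e : rel 'I_n) : Prop :=
  forall i j, connect e i j.

Definition graph_aut (n : nat) (e : rel 'I_n) : {set {perm 'I_n}} :=
  [set s : {perm 'I_n} | [forall i, forall j, e (s i) (s j) == e i j]].

Lemma graph_autP (n : nat) (e : rel 'I_n) (s : {perm 'I_n}) :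
  reflect (forall i j, e (s i) (s j) = e i j) (s \in graph_aut e).
Proof.
rewrite inE; apply: (iffP forallP) => [h i j|h i].
  by move/forallP: (h i) => /(_ j)/eqP.
by apply/forallP => j; rewrite h.
Qed.

Lemma group_set_graph_aut (n : nat) (e : rel 'I_n) : group_set (graph_aut e).
Proof.
apply/group_setP; split=> [|s t /graph_autP hs /graph_autP ht].
  by apply/graph_autP => i j; rewrite !perm1.
by apply/graph_autP => i j; rewrite !permM ht hs.
Qed.

Canonical graph_aut_group (n : nat) (e : rel 'I_n) : {group {perm 'I_n}} :=
  Group (group_set_graph_aut e).

(* ['P^*] is the action of permutations on sets, s({i, j}) = {s(i), s(j)}. *)
Definition edge_orbits (n : nat) (e : rel 'I_n) : {set {set {set 'I_n}}} :=
  orbit ('P^*)%act (graph_aut e) @: edges e.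

Lemma graph_aut_acts_edges (n : nat) (e : rel 'I_n) :
  [acts graph_aut e, on edges e | ('P^*)%act].
Proof.
apply/subsetP => s /graph_autP hs; rewrite !inE /=; apply/subsetP => A.
case/imsetP => p; rewrite inE => ep ->; rewrite inE /= /setact.
apply/imsetP; exists (s p.1, s p.2); first by rewrite inE hs.
by rewrite imsetU !imset_set1.
Qed.

Definition fmmc_feasible (R : realType) (n : nat) (e : rel 'I_n)
    (P : 'M[R]_n) : Prop :=
  [/\ forall i j, 0 <= P i j,
      P *m const_mx 1 = const_mx 1 :> 'cV[R]_n,
      P = P^T
    & forall i j, i != j -> ~~ e i j -> P i j = 0].

(* The real eigenvalues, repeated according to their multiplicity as roots of
   the characteristic polynomial, in nonincreasing order; for a symmetric
   matrix these are all n eigenvalues. *)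
Definition eigenvalues (R : realType) (n : nat) (P : 'M[R]_n) : seq R :=
  sort >=%R (flatten
    [seq nseq (mup a (char_poly P)) a | a <- rootsR (char_poly P)]).

Lemma eigenvalues_split (R : realType) (n : nat) (P : 'M[R]_n) (s : seq R) :
  char_poly P = \prod_(a <- s) ('X - a%:P) -> eigenvalues P = sort >=%R s.
Proof.
move=> Ps; apply/perm_sortP; [exact: ge_total|exact: ge_trans|exact: ge_anti|].
have P0 : char_poly P != 0 by rewrite monic_neq0 ?char_poly_monic.
have mupE b : mup b (char_poly P) = count_mem b s.
  rewrite Ps; elim: s {Ps} => [|c s IHs] /=.
    by rewrite big_nil mupNroot // rootE hornerC oner_eq0.
  have s0 : \prod_(a <- s) ('X - a%:P) != 0.
    by rewrite monic_neq0 // monic_prod_XsubC.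
  rewrite big_cons mupM ?polyXsubC_eq0 // IHs.
  by have := mup_XsubCX 1 b c; rewrite expr1 => ->; case: eqP.
have nseqE (r : seq R) b : uniq r ->
    count_mem b (flatten [seq nseq (count_mem a s) a | a <- r]) =
    ((b \in r) * count_mem b s)%N.
  elim: r => //= c r IHr /andP[cNr /IHr {}IHr].
  rewrite count_cat IHr count_nseq in_cons /= eq_sym.
  case: (eqVneq b c) => [->|_] /=; last by rewrite mul0n.
  by rewrite (negPf cNr) mul0n addn0.
under eq_map => a do rewrite mupE.
apply/allP => b _ /=; rewrite nseqE; last exact: uniq_roots.
rewrite -(roots_on_rootsR P0) in_itv /= Ps root_prod_XsubC.
by have [|/count_memPn->] := boolP (b \in s); rewrite ?mul1n ?muln0.
Qed.

(* mu(P) = max_(2 <= i <= n) |lambda_i(P)|; the sequence is indexed from 0,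
   and the maximum is 0 when n <= 1, as is the norm of P - (1/n) 1 1^T. *)
Definition slem (R : realType) (n : nat) (P : 'M[R]_n) : R :=
  \big[Num.max/0]_(1 <= i < n) `|(eigenvalues P)`_i|.

Definition fmmc_optimal (R : realType) (n : nat) (e : rel 'I_n)
    (P : 'M[R]_n) : Prop :=
  fmmc_feasible e P /\ forall Q, fmmc_feasible e Q -> slem P <= slem Q.

Definition edge_probabilities (R : realType) (n : nat) (e : rel 'I_n)
    (P : 'M[R]_n) : seq R :=
  undup [seq P p.1 p.2 | p : 'I_n * 'I_n in [pred p | e p.1 p.2]].

(* Main.v *)
Require Import Defs.
From mathcomp Require Import all_boot all_order all_algebra all_fingroup reals.
From mathcomp Require Import complex ring lra.
From mathcomp Require Import classical_sets topology normedtype derive.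

(* For feasible P the all-ones vector is an eigenvector for the largest
   eigenvalue 1, so the remaining eigenvalues are those of P - (1/n) 1 1^T with
   one 0 removed, and slem P <= t means |x (P - (1/n) 1 1^T) x^T| <= t |x|^2 for
   all real x.  Hence slem is Lipschitz on the compact feasible set and attains
   its minimum.  The bound is convex in P and preserved by relabelling the
   vertices, so averaging a minimizer over Aut(G) yields a minimizer which is
   constant on the edge orbits. *)

Set Implicit Arguments.
Unset Strict Implicit.
Unset Printing Implicit Defensive.

Import Order.TTheory GRing.Theory Num.Theory.
Import numFieldNormedType.Exports.
Local Open Scope ring_scope.

(** * Characteristic polynomials under rank-one updates and similarity *)

(** Block elimination: the determinant of [L] is the Schur complement determinant, and right
    multiplication by the block matrix with rows [(x, 0)] and [(-u, 1)], of determinant [x], makes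
    [L] block triangular. The extra factor [x] on the left avoids the exponent [n - 1]. *)
Lemma det_scalar_sub_rank1 (S : comNzRingType) (n : nat) (u : 'cV[S]_n)
    (v : 'rV[S]_n) (x c : S) :
  v *m u = c%:M -> \det (x%:M - u *m v) * x = (x - c) * x ^+ n.
Proof.
move=> vu.
pose L : 'M_(1 + n) := block_mx 1%:M v u x%:M.
have -> : \det (x%:M - u *m v) = \det L.
  have -> : L = block_mx 1%:M 0 u 1%:M *m block_mx 1%:M v 0 (x%:M - u *m v).
    by rewrite mulmx_block !mul1mx !mul0mx !mulmx1 !addr0 addrC subrK.
  by rewrite det_mulmx det_lblock det_ublock !det1 !mul1r.
have detx : \det (block_mx x%:M 0 (- u) 1%:M : 'M_(1 + n)) = x.
  by rewrite det_lblock det_scalar1 det1 mulr1.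
rewrite -[X in _ * X = _]detx -det_mulmx mulmx_block.
rewrite !mul1mx !mulmx1 !mulmx0 !add0r mulmxN vu.
rewrite mul_mx_scalar mul_scalar_mx scalerN subrr det_ublock det_scalar.
by rewrite -raddfB det_scalar1.
Qed.

(** Adding [u *m v] moves one eigenvalue of [M] from 0 to 1. As [M u = 0], the product of [X - M]
    and [X - u v] is [X (X - M - u v)]; take determinants and cancel [X^n]. *)
Lemma char_poly_add_rank1 (R : idomainType) (n : nat) (M : 'M[R]_n)
    (u : 'cV[R]_n) (v : 'rV[R]_n) :
  M *m u = 0 -> v *m u = 1%:M ->
  'X * char_poly (M + u *m v) = ('X - 1) * char_poly M.
Proof.
move=> Mu vu.
have X0 : 'X ^+ n != 0 :> {poly R} by rewrite expf_neq0 // polyX_eq0.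
have vuC : map_mx polyC v *m map_mx polyC u = 1%:M :> 'M[{poly R}]_1.
  by rewrite -map_mxM vu map_mx1.
have := det_scalar_sub_rank1 'X vuC; rewrite -map_mxM => detuv.
have splitM : char_poly_mx M *m ('X%:M - map_mx polyC (u *m v)) =
    'X%:M *m char_poly_mx (M + u *m v).
  rewrite /char_poly_mx mulmxBl !mulmxBr -map_mxM mulmxA Mu mul0mx raddf0 subr0.
  rewrite map_mxD mulmxDr opprD addrA addrAC; congr (_ - _ - _).
  by rewrite mul_scalar_mx mul_mx_scalar.
have := congr1 (fun A => \det A * 'X) splitM.
rewrite !det_mulmx det_scalar -mulrA detuv -/(char_poly _) -/(char_poly M) => E.
apply: (mulfI X0); rewrite [X in _ * X = _]mulrC mulrA -E mulrA [RHS]mulrC.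
by rewrite [char_poly M * _]mulrC.
Qed.

Lemma char_poly_similar (F : fieldType) (n : nat) (V A : 'M[F]_n) :
  V \in unitmx -> char_poly (invmx V *m A *m V) = char_poly A.
Proof.
move=> uV.
have VV : map_mx polyC (invmx V) *m map_mx polyC V = 1%:M.
  by rewrite -map_mxM mulVmx // map_mx1.
rewrite /char_poly.
have -> : char_poly_mx (invmx V *m A *m V) =
    map_mx polyC (invmx V) *m char_poly_mx A *m map_mx polyC V.
  rewrite /char_poly_mx mulmxBr mulmxBl !map_mxM; congr (_ - _).
  by rewrite mul_mx_scalar -scalemxAl VV scalemx1.
by rewrite !det_mulmx mulrAC -det_mulmx VV det1 mul1r.
Qed.


(** * Spectral theorem for real symmetric matrices *)

Section SymmetricSpectrum.
Local Open Scope sesquilinear_scope.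

(** Over the complex extension [A] is Hermitian, hence unitarily diagonalizable with real spectrum;
    both conclusions are then read off the diagonal form and brought back to [R]. *)
Lemma symmetric_spectrum (R : rcfType) (n : nat) (A : 'M[R]_n) :
  A = A^T ->
  exists2 a : 'I_n -> R,
    char_poly A = \prod_i ('X - (a i)%:P) &
    forall t : R, (forall i, `|a i| <= t) ->
    forall x : 'rV[R]_n, `|(x *m A *m x^T) 0 0| <= t * (x *m x^T) 0 0.
Proof.
move=> Asym; pose toC := real_complex R; pose Ac := map_mx toC A.
have toCreal p q (B : 'M[R]_(p, q)) : map_mx toC B \is a mxOver Num.real.
  by apply/mxOverP => i j; rewrite mxE complex_real.
have Aherm : Ac \is hermsymmx.
  apply: realsym_hermsym; last exact: toCreal.
  apply/is_hermitianmxP; rewrite expr0 scale1r map_mx_id //.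
  by rewrite /Ac map_trmx -Asym.
have /orthomx_spectralP := hermitian_normalmx Aherm.
have := hermitian_spectral_diag_real Aherm.
have := spectral_unitarymx Ac.
move: (spectralmx _) (spectral_diag _) => U d Uu dreal AE.
have Uunit := unitarymx_unit Uu.
pose a i := complex.Re (d 0 i).
have dE i : d 0 i = toC (a i) by rewrite /toC RRe_real //; apply/mxOverP.
exists a.
  apply: (map_poly_inj toC); rewrite map_char_poly -/Ac AE.
  rewrite char_poly_similar // char_poly_trig ?diag_mx_is_trig // rmorph_prod.
  apply: eq_bigr => i _; rewrite mxE eqxx mulr1n dE rmorphB /=.
  by rewrite map_polyX map_polyC.
move=> t ta x.
(* Coordinates of [x] in the eigenbasis: the two forms become the sums of [a i * |y_i|^2] and of
   [|y_i|^2], which are compared term by term. *)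
pose y := map_mx toC x *m U^t*.
have xreal : (map_mx toC x)^t* = map_mx toC x^T.
  by rewrite map_trmx realmxC // map_trmx.
have xAx : toC ((x *m A *m x^T) 0 0) = \sum_i toC (a i) * `|y 0 i| ^+ 2.
  have -> : toC ((x *m A *m x^T) 0 0) = (map_mx toC (x *m A *m x^T)) 0 0.
    by rewrite [RHS]mxE.
  rewrite !map_mxM -/Ac AE invmx_unitary // !mulmxA -/y -xreal.
  rewrite -[_ *m U *m _]mulmxA.
  have <- : (y ^t*) = U *m (map_mx toC x)^t*.
    by rewrite /y trmx_mul map_mxM trmxCK.
  rewrite -mulmxA mxE; apply: eq_bigr => i _; rewrite mul_diag_mx !mxE dE.
  by rewrite mulrCA normCK.
have xx : toC ((x *m x^T) 0 0) = \sum_i `|y 0 i| ^+ 2.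
  have -> : toC ((x *m x^T) 0 0) = (y *m y^t*) 0 0.
    rewrite /y trmx_mul map_mxM trmxCK mulmxA -[_ *m U^t* *m U]mulmxA.
    by rewrite -(invmx_unitary Uu) mulVmx // mulmx1 xreal -map_mxM [RHS]mxE.
  by rewrite mxE; apply: eq_bigr => i _; rewrite !mxE normCK.
have toC_le r s : (r <= s) = (toC r <= toC s) by rewrite lecR.
have toCN r : toC (- r) = - toC r by apply: (rmorphN (real_complex R)).
have toCM r s : toC (r * s) = toC r * toC s.
  by apply: (rmorphM (real_complex R)).
rewrite ler_norml !toC_le toCN toCM xAx xx.
rewrite mulr_sumr -sumrN; apply/andP.
by split; apply: ler_sum => i _; rewrite -?mulNr -?toCN;
  apply: ler_wpM2r; rewrite ?exprn_ge0 // -toC_le; have := ta i;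
  rewrite ler_norml => /andP[].
Qed.

End SymmetricSpectrum.

(** * Quadratic forms of feasible matrices *)

Definition qform (R : realType) (n : nat) (A : 'M[R]_n) (x : 'rV[R]_n) : R :=
  (x *m A *m x^T) 0 0.

Definition sqnorm (R : realType) (n : nat) (x : 'rV[R]_n) : R := (x *m x^T) 0 0.

(** For [n > 0], the constant matrix is the orthogonal projection onto the constant vectors. *)
Definition deflate (R : realType) (n : nat) (P : 'M[R]_n) : 'M[R]_n :=
  P - const_mx n%:R^-1.

Section QuadraticForm.
Variables (R : realType) (n : nat).
Implicit Types (A P : 'M[R]_n) (x : 'rV[R]_n).

Lemma sqnormE x : sqnorm x = \sum_i x 0 i ^+ 2.
Proof. by rewrite /sqnorm mxE; apply: eq_bigr => i _; rewrite mxE expr2. Qed.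

Lemma sqnorm_ge0 x : 0 <= sqnorm x.
Proof. by rewrite sqnormE sumr_ge0 // => i _; exact: sqr_ge0. Qed.

Lemma sqnorm_gt0 x : x != 0 -> 0 < sqnorm x.
Proof.
move=> x0; rewrite lt_neqAle sqnorm_ge0 andbT eq_sym; apply: contra_neq x0.
rewrite sqnormE => /eqP.
rewrite psumr_eq0 => [/allP h|i _]; last exact: sqr_ge0.
apply/rowP => i; rewrite mxE; apply/eqP.
by rewrite -sqrf_eq0; exact/h/mem_index_enum.
Qed.

Lemma qformE A x : qform A x = \sum_i \sum_j A i j * (x 0 i * x 0 j).
Proof.
rewrite /qform mxE exchange_big; apply: eq_bigr => j _ /=.
rewrite !mxE mulr_suml.
by apply: eq_bigr => i _; rewrite mulrAC mulrC mulrA.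
Qed.

Lemma qform_eigen A x a : x *m A = a *: x -> qform A x = a * sqnorm x.
Proof. by rewrite /qform /sqnorm => ->; rewrite -scalemxAl mxE. Qed.

Lemma qformB A B x : qform (A - B) x = qform A x - qform B x.
Proof. by rewrite /qform mulmxBr mulmxBl !mxE. Qed.

Lemma feasible_row (e : rel 'I_n) P i : fmmc_feasible e P -> \sum_j P i j = 1.
Proof.
case=> _ /colP/(_ i); rewrite !mxE => + _ _; under eq_bigr do rewrite mxE mulr1.
by [].
Qed.

Lemma feasible_sym (e : rel 'I_n) P i j : fmmc_feasible e P -> P i j = P j i.
Proof. by case=> _ _ PT _; rewrite {1}PT mxE. Qed.

(** Weight [2 x_i x_j <= x_i^2 + x_j^2] by [P i j] and sum; rows and columns each add up to 1. This
    bounds every eigenvalue of [P] by 1. *)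
Lemma qform_feasible_le (e : rel 'I_n) P x :
  fmmc_feasible e P -> qform P x <= sqnorm x.
Proof.
move=> feasP; have [P0 _ _ _] := feasP.
have rows : \sum_i \sum_j P i j * x 0 i ^+ 2 = sqnorm x.
  rewrite sqnormE; apply: eq_bigr => i _.
  by rewrite -mulr_suml (feasible_row _ feasP) mul1r.
have cols : \sum_i \sum_j P i j * x 0 j ^+ 2 = sqnorm x.
  rewrite exchange_big -rows; apply: eq_bigr => j _ /=.
  by apply: eq_bigr => i _; rewrite (feasible_sym _ _ feasP).
suff : qform P x *+ 2 <= sqnorm x *+ 2 by rewrite lerMn2r.
rewrite mulr2n [leRHS]mulr2n -{1}rows -cols qformE -!big_split.
apply: ler_sum => i _; rewrite -!big_split; apply: ler_sum => j _ /=.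
rewrite -!mulrDr; apply: ler_wpM2l => //.
by have := sqr_ge0 (x 0 i - x 0 j); nra.
Qed.

Lemma deflate_rank1 (P : 'M[R]_n) :
  P = deflate P + (const_mx 1 : 'cV_n) *m (const_mx n%:R^-1 : 'rV_n).
Proof.
by apply/matrixP=> i j; rewrite !mxE big_ord1 !mxE mul1r subrK.
Qed.

Lemma deflate_sym (P : 'M[R]_n) : P = P^T -> deflate P = (deflate P)^T.
Proof. by move=> PT; rewrite /deflate linearB /= -PT trmx_const. Qed.

(** The bound has to be nonnegative because the maximum starts from 0. *)
Lemma bigmax_seq_leP (r : seq R) (t : R) : 0 <= t ->
  reflect {in r, forall a, `|a| <= t} (\big[Num.max/0]_(a <- r) `|a| <= t).
Proof.
move=> t0; elim: r => [|a r IHr]; first by rewrite big_nil t0; apply: ReflectT.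
rewrite big_cons ge_max; apply: (iffP andP) => [[ha /IHr hr] b|h].
  by rewrite in_cons => /predU1P[->//|/hr].
split; first by apply: h; rewrite mem_head.
by apply/IHr => b br; apply: h; rewrite in_cons br orbT.
Qed.

End QuadraticForm.

(** * The second largest eigenvalue modulus as a quadratic form bound *)

(** Since no element of [s] exceeds 1, the root of ['X - 1] can be put at the head of the sorted
    list, the entry that [slem] skips. This also covers 1 occurring again in [s]. *)
Lemma slem_split (R : realType) (n : nat) (P : 'M[R]_n) (s : seq R) :
  char_poly P = ('X - 1) * \prod_(a <- s) ('X - a%:P) ->
  {in s, forall a, a <= 1} -> slem P = \big[Num.max/0]_(a <- s) `|a|.
Proof.
move=> Ps s1.
have szs : n = (size s).+1.
  apply: succn_inj; rewrite -(size_char_poly P) Ps.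
  have := size_prod_XsubC (1 :: s) id; rewrite big_cons => -> //.
have eigP : eigenvalues P = 1 :: sort >=%R s.
  have /eigenvalues_split -> : char_poly P = \prod_(a <- 1 :: s) ('X - a%:P).
    by rewrite big_cons.
  apply: (sorted_eq ge_trans ge_anti).
  - by apply: sort_sorted => x y; apply: ge_total.
  - rewrite /= path_min_sorted.
      by apply: sort_sorted => x y; apply: ge_total.
    by apply/allP => a; rewrite mem_sort; apply: s1.
  - by rewrite perm_sort perm_cons perm_sym perm_sort.
rewrite /slem eigP szs big_add1 /=.
rewrite -(perm_big _ (permEl (perm_sort >=%R s))) /=.
by rewrite [RHS](big_nth 0) size_sort.
Qed.

(** The spectrum of [deflate P] is that of [P] with one 1 replaced by 0, and a zero eigenvalue does
    not affect the bound. One direction is the spectral bound, the other tests the form on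
    eigenvectors. *)
Lemma slem_leP (R : realType) (n : nat) (e : rel 'I_n) (P : 'M[R]_n) (t : R) :
  (0 < n)%N -> fmmc_feasible e P -> 0 <= t ->
  slem P <= t <-> forall x, `|qform (deflate P) x| <= t * sqnorm x.
Proof.
move=> n0 feasP t0; have [_ P1 PT _] := feasP.
have nR : n%:R != 0 :> R by rewrite pnatr_eq0 -lt0n.
pose u : 'cV[R]_n := const_mx 1; pose v : 'rV[R]_n := const_mx n%:R^-1.
have vu : v *m u = 1%:M.
  apply/matrixP => i j; rewrite !ord1 !mxE.
  under eq_bigr do rewrite !mxE mulr1.
  by rewrite sumr_const card_ord -[LHS]mulr_natr mulVf.
have Mu : deflate P *m u = 0.
  have /eqP := deflate_rank1 P; rewrite -subr_eq => /eqP <-.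
  by rewrite mulmxBl P1 -mulmxA vu mulmx1 subrr.
have := char_poly_add_rank1 Mu vu; rewrite -deflate_rank1.
have [a Ma bound] := symmetric_spectrum (deflate_sym PT); rewrite Ma => charP.
(* Evaluating [charP] at 0 kills the left side, so some factor ['X - a i] vanishes at 0. *)
have [i0 ai0] : exists i0, a i0 = 0.
  have := congr1 (fun p => p.[0]) charP; rewrite !hornerM hornerX mul0r.
  rewrite hornerD hornerX hornerN hornerC => /esym/eqP.
  rewrite mulf_eq0 sub0r oppr_eq0 oner_eq0 /= horner_prod.
  case/prodf_eq0 => i _; rewrite hornerXsubC sub0r oppr_eq0 => /eqP.
  by exists i.
(* Dropping the index of this zero matches cancelling ['X] in [charP]. *)
pose s := [seq a i | i <- rem i0 (index_enum 'I_n)].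
have Ms : char_poly P = ('X - 1) * \prod_(b <- s) ('X - b%:P).
  have X0 : 'X != 0 :> {poly R} by rewrite polyX_eq0.
  apply: (mulfI X0); rewrite charP.
  rewrite (bigD1_seq i0) ?mem_index_enum ?index_enum_uniq //=.
  rewrite ai0 subr0 mulrCA; congr (_ * (_ * _)).
  by rewrite big_map rem_filter ?index_enum_uniq // big_filter.
(* Each [b] is an eigenvalue of [P]; its eigenvector has Rayleigh quotient [b]. *)
have s_le1 : {in s, forall b, b <= 1}.
  move=> b sb; have : root (char_poly P) b.
    by rewrite Ms rootM root_prod_XsubC sb orbT.
  rewrite -eigenvalue_root_char => /eigenvalueP[x xP x0].
  have := qform_feasible_le x feasP; rewrite (qform_eigen xP).
  by rewrite -ler_pdivlMr ?sqnorm_gt0 // divff // gt_eqF ?sqnorm_gt0.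
rewrite (slem_split Ms s_le1); split.
  move=> /(bigmax_seq_leP _ t0) hs; apply: bound => i.
  have [->|ii0] := eqVneq i i0; first by rewrite ai0 normr0.
  apply/hs/map_f; rewrite rem_filter ?index_enum_uniq // mem_filter /= ii0.
  exact: mem_index_enum.
move=> hx; apply/(bigmax_seq_leP _ t0) => b /mapP[i _ ->].
have : root (char_poly (deflate P)) (a i).
  by rewrite Ma (bigD1 i) //= rootM root_XsubC eqxx.
rewrite -eigenvalue_root_char => /eigenvalueP[x xP x0].
have := hx x; rewrite (qform_eigen xP) normrM (ger0_norm (sqnorm_ge0 x)).
by rewrite ler_pM2r // sqnorm_gt0.
Qed.

(** * Averaging over the automorphism group *)

Lemma set2_inj (T : finType) (a b c d : T) :
  [set a; b] = [set c; d] -> (a = c /\ b = d) \/ (a = d /\ b = c).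
Proof.
move=> E; have : a \in [set c; d] by rewrite -E set21.
have : b \in [set c; d] by rewrite -E set22.
have : c \in [set a; b] by rewrite E set21.
have : d \in [set a; b] by rewrite E set22.
by do 4!case/set2P => ?;
  solve [left; split; congruence | right; split; congruence].
Qed.

Section Averaging.
Variables (R : realType) (n : nat) (e : rel 'I_n).
Implicit Types (P Q : 'M[R]_n) (s : {perm 'I_n}).

Lemma slem_ge0 P : 0 <= slem P.
Proof. by rewrite /slem; apply: bigmax_ge_id. Qed.

Definition relabel s P : 'M[R]_n := \matrix_(i, j) P (s i) (s j).

Definition aut_average P : 'M[R]_n :=
  #|graph_aut e|%:R^-1 *: \sum_(s in graph_aut e) relabel s P.

Lemma aut_averageE P i j :
  aut_average P i j =
  #|graph_aut e|%:R^-1 * \sum_(s in graph_aut e) P (s i) (s j).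
Proof.
by rewrite mxE summxE; congr (_ * _); apply: eq_bigr => s _; rewrite mxE.
Qed.

Lemma card_graph_aut_gt0 : 0 < #|graph_aut e|%:R :> R.
Proof. by rewrite ltr0n cardG_gt0. Qed.

Lemma average_cst (c : R) :
  #|graph_aut e|%:R^-1 * \sum_(s in graph_aut e) c = c.
Proof.
by rewrite sumr_const -[c *+ _]mulr_natl mulKf // gt_eqF ?card_graph_aut_gt0.
Qed.

(** Relabelling by an automorphism permutes the terms of row sums and sends non-edges to non-edges;
    the constraints then pass to the mean. *)
Lemma aut_average_feasible P :
  fmmc_feasible e P -> fmmc_feasible e (aut_average P).
Proof.
move=> feasP; have [P0 _ _ Pe] := feasP; split.
- move=> i j; rewrite aut_averageE mulr_ge0 ?invr_ge0 ?ler0n //.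
  by apply: sumr_ge0 => s _.
- apply/colP => i; rewrite !mxE.
  transitivity (#|graph_aut e|%:R^-1 *
      \sum_j \sum_(s in graph_aut e) P (s i) (s j)).
    by rewrite mulr_sumr; apply: eq_bigr => j _; rewrite aut_averageE mxE mulr1.
  rewrite exchange_big /= -[RHS]average_cst; congr (_ * _).
  apply: eq_bigr => s _; rewrite -(feasible_row (s i) feasP).
  by rewrite [RHS](reindex_inj (@perm_inj _ s)).
- apply/matrixP => i j; rewrite [RHS]mxE !aut_averageE; congr (_ * _).
  by apply: eq_bigr => s _; rewrite (feasible_sym _ _ feasP).
- move=> i j ij eij; rewrite aut_averageE big1 ?mulr0 // => s /graph_autP sG.
  by apply: Pe; rewrite ?(inj_eq perm_inj) // sG.
Qed.

(** Relabelling the matrix by [s] amounts to permuting the vector by the inverse of [s]. *)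
Lemma qform_aut_average (A : 'M[R]_n) x :
  qform (aut_average A) x = #|graph_aut e|%:R^-1 *
    \sum_(s in graph_aut e) qform A (\row_i x 0 ((s^-1)%g i)).
Proof.
rewrite /qform -scalemxAr -scalemxAl mxE mulmx_sumr mulmx_suml summxE.
congr (_ * _); apply: eq_bigr => s _; rewrite -!/(qform _ _) !qformE.
rewrite [RHS](reindex_inj (@perm_inj _ s)); apply: eq_bigr => i _ /=.
rewrite [RHS](reindex_inj (@perm_inj _ s)); apply: eq_bigr => j _ /=.
by rewrite !mxE !permK.
Qed.

Lemma deflate_aut_average P : deflate (aut_average P) = aut_average (deflate P).
Proof.
apply/matrixP => i j; rewrite aut_averageE [LHS]mxE aut_averageE.
under [in RHS]eq_bigr do rewrite !mxE.
by rewrite sumrB mulrBr average_cst !mxE.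
Qed.

(** By the triangle inequality the form of the average is at most the mean of the forms of
    [deflate P] at permuted copies of [x], which all have the norm of [x]. *)
Lemma aut_average_slem P : (0 < n)%N -> fmmc_feasible e P ->
  slem (aut_average P) <= slem P.
Proof.
move=> n0 feasP; have feasA := aut_average_feasible feasP.
apply/(slem_leP n0 feasA (slem_ge0 P)) => x.
rewrite deflate_aut_average qform_aut_average.
rewrite normrM ger0_norm ?invr_ge0 ?ler0n // -[leRHS]average_cst.
apply: ler_wpM2l; first by rewrite invr_ge0 ler0n.
apply: le_trans (ler_norm_sum _ _ _) _; apply: ler_sum => s _.
have -> : sqnorm x = sqnorm (\row_i x 0 ((s^-1)%g i)).
  rewrite !sqnormE [LHS](reindex_inj (@perm_inj _ s^-1)%g) /=.
  by apply: eq_bigr => i _; rewrite mxE.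
by apply: (slem_leP n0 feasP (slem_ge0 P)).1.
Qed.

Lemma aut_average_invariant P s i j : s \in graph_aut e ->
  aut_average P (s i) (s j) = aut_average P i j.
Proof.
move=> sG; rewrite !aut_averageE; congr (_ * _).
rewrite [RHS](reindex_inj (mulgI s)) /=; apply: eq_big => [t|t _].
  by rewrite groupMl.
by rewrite !permM.
Qed.

(** Every edge probability is the image under [g] of the orbit of its edge, so the orbits bound the
    number of values. *)
Lemma edge_probabilities_invariant P :
  (forall i j, P i j = P j i) ->
  (forall s i j, s \in graph_aut e -> P (s i) (s j) = P i j) ->
  (size (edge_probabilities e P) <= #|edge_orbits e|)%N.
Proof.
move=> Psym Pinv.
(* The value of [P] at a chosen edge of the orbit; the default 0 never occurs on the orbit of an
   edge. *)
pose g (O : {set {set 'I_n}}) : R :=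
  if [pick p : 'I_n * 'I_n | [set p.1; p.2] \in O] is Some p
  then P p.1 p.2 else 0.
rewrite cardE -(size_map g); apply: uniq_leq_size; first exact: undup_uniq.
move=> r; rewrite mem_undup => /fintype.imageP[p]; rewrite inE => ep ->.
apply/mapP; exists (orbit ('P^*)%act (graph_aut e) [set p.1; p.2]).
  by rewrite mem_enum; apply: imset_f; apply: imset_f; rewrite inE.
rewrite /g; case: pickP => [q|/(_ p)]; last by rewrite orbit_refl.
case/orbitP => s sG /=; rewrite /setact imsetU !imset_set1 /= => sp.
rewrite -(Pinv s) //.
(* The automorphism may exchange the ends of the edge, whence the appeal to symmetry. *)
by case: (set2_inj sp) => -[<- <-] //; rewrite Psym.
Qed.

End Averaging.

(** * Existence of a minimizer by compactness *)

Section Minimizer.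
Variables (R : realType) (n : nat) (e : rel 'I_n).
Implicit Types (P Q : 'M[R]_n).

(** Apply [2 |x_i x_j| <= x_i^2 + x_j^2] to each entry; each square then occurs [2n] times. The
    crude factor [n] suffices for continuity. *)
Lemma norm_qform_le (A : 'M[R]_n) (d : R) x : (forall i j, `|A i j| <= d) ->
  `|qform A x| <= n%:R * d * sqnorm x.
Proof.
move=> Ad.
have sum_sq : \sum_(i < n) \sum_(j < n) d * (x 0 i ^+ 2 + x 0 j ^+ 2) =
    n%:R * d * sqnorm x *+ 2.
  under eq_bigr do rewrite -mulr_sumr big_split /= sumr_const card_ord -sqnormE.
  rewrite -mulr_sumr big_split /= sumr_const card_ord sumrMnl -sqnormE.
  by rewrite -[sqnorm x *+ n]mulr_natl; ring.
suff : `|qform A x| *+ 2 <= n%:R * d * sqnorm x *+ 2 by rewrite lerMn2r.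
rewrite -sum_sq qformE -normrMn -sumrMnl.
apply: le_trans (ler_norm_sum _ _ _) _; apply: ler_sum => i _.
rewrite -sumrMnl; apply: le_trans (ler_norm_sum _ _ _) _; apply: ler_sum => j _.
rewrite normrMn !normrM.
have h : `|x 0 i| * `|x 0 j| *+ 2 <= x 0 i ^+ 2 + x 0 j ^+ 2.
  rewrite -[x 0 i ^+ 2]real_normK ?num_real //.
  rewrite -[x 0 j ^+ 2]real_normK ?num_real //.
  by have := sqr_ge0 (`|x 0 i| - `|x 0 j|); nra.
rewrite -mulrnAr; apply: ler_pM => //.
by rewrite mulrn_wge0 ?mulr_ge0.
Qed.

(** The constant matrices cancel in the difference of the deflations, so only the form of [Q - P]
    has to be added to the bound for [Q]. *)
Lemma slem_lipschitz P Q (d : R) : (0 < n)%N ->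
  fmmc_feasible e P -> fmmc_feasible e Q ->
  (forall i j, `|P i j - Q i j| <= d) -> slem P <= slem Q + n%:R * d.
Proof.
move=> n0 feasP feasQ PQ.
have d0 : 0 <= d := le_trans (normr_ge0 _) (PQ (Ordinal n0) (Ordinal n0)).
have t0 : 0 <= slem Q + n%:R * d by rewrite addr_ge0 ?slem_ge0 ?mulr_ge0.
apply/(slem_leP n0 feasP t0) => x.
have -> : deflate P = deflate Q - (Q - P).
  by apply/matrixP => i j; rewrite !mxE; ring.
rewrite qformB (le_trans (ler_normB _ _)) // mulrDl lerD //.
  exact: (slem_leP n0 feasQ (slem_ge0 Q)).1.
by apply: norm_qform_le => i j; rewrite !mxE distrC.
Qed.

Local Open Scope classical_set_scope.

(** Matrices are flattened to row vectors so that compactness of a product of segments applies. *)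
Let feasible_vec : set 'rV[R]_(n * n) := [set v | fmmc_feasible e (vec_mx v)].

Lemma closed_feasible_vec : closed feasible_vec.
Proof.
pose entry i j (v : 'rV[R]_(n * n)) := v 0 (mxvec_index i j).
have entry_cont i j : continuous (entry i j) by exact: coord_continuous.
(* Each constraint is a closed condition on a continuous function of the entries; symmetry is
   written as vanishing differences. *)
have -> : feasible_vec =
    \bigcap_(ij in [set: 'I_n * 'I_n])
      (entry ij.1 ij.2 @^-1` [set r | 0 <= r]) `&`
    (\bigcap_(i in [set: 'I_n])
      ((fun v => \sum_j entry i j v) @^-1` [set r | r = 1]) `&`
    (\bigcap_(ij in [set: 'I_n * 'I_n])
      ((fun v => entry ij.1 ij.2 v - entry ij.2 ij.1 v) @^-1` [set r | r = 0])
     `&`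
     \bigcap_(ij in [set ij : 'I_n * 'I_n | (ij.1 != ij.2) && ~~ e ij.1 ij.2])
      (entry ij.1 ij.2 @^-1` [set r | r = 0]))).
  apply/seteqP; split=> v.
    move=> feas; have [P0 _ _ Pe] := feas; split=> [[i j] _ /=|].
      by have := P0 i j; rewrite mxE.
    split=> [i _ /=|].
      rewrite -[RHS](feasible_row i feas).
      by apply: eq_bigr => j _; rewrite mxE.
    split=> [[i j] _ /=|[i j] /andP[/= ij eij]].
      have := feasible_sym i j feas; rewrite !mxE /entry => ->.
      by rewrite subrr.
    by have := Pe i j ij eij; rewrite mxE.
  case=> P0 [P1 [PT Pe]]; split.
  - by move=> i j; rewrite mxE; apply: (P0 (i, j)).
  - apply/colP => i; rewrite !mxE -[RHS](P1 i) //.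
    by apply: eq_bigr => j _; rewrite !mxE mulr1.
  - apply/matrixP => i j; rewrite !mxE; apply/eqP; rewrite -subr_eq0.
    by apply/eqP/(PT (i, j)).
  - by move=> i j ij eij; rewrite mxE; apply: (Pe (i, j)); rewrite /= ij eij.
apply: closedI.
  apply: closed_bigI => ij _; apply: preimage_closed; last exact: closed_ge.
  by move=> ? _; apply: entry_cont.
apply: closedI.
  apply: closed_bigI => i _; apply: preimage_closed; last exact: closed_eq.
  move=> v _; apply: continuous_big => //; exact: add_continuous.
apply: closedI.
  apply: closed_bigI => ij _; apply: preimage_closed; last exact: closed_eq.
  by move=> v _; apply: continuousB; apply: entry_cont.
apply: closed_bigI => ij _; apply: preimage_closed; last exact: closed_eq.
by move=> ? _; apply: entry_cont.
Qed.

(** A closed subset of the unit cube: a nonnegative entry is at most its row sum, which is 1. *)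
Lemma compact_feasible_vec : compact feasible_vec.
Proof.
apply: (subclosed_compact closed_feasible_vec
  (rV_compact (fun _ : 'I_(n * n) => @segment_compact R 0 1))) => v feas k /=.
case/mxvec_indexP: k => i j; have [P0 _ _ _] := feas.
have := P0 i j; have := feasible_row i feas.
rewrite (bigD1 j) //= mxE in_itv /= => <- ->; rewrite lerDl.
by apply: sumr_ge0 => k _.
Qed.

Lemma fmmc_optimal_exists : (0 < n)%N -> exists P : 'M[R]_n, fmmc_optimal e P.
Proof.
move=> n0.
have ne : feasible_vec !=set0.
  (* The identity, the chain that never moves, is feasible for every graph. *)
  exists (mxvec 1%:M); rewrite /feasible_vec /= mxvecK; split.
  - by move=> i j; rewrite mxE ler0n.
  - by rewrite mul1mx.
  - by rewrite trmx1.
  - by move=> i j ij _; rewrite mxE (negPf ij).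
have cont : {within feasible_vec,
    continuous (fun v => slem (vec_mx v : 'M[R]_n))}.
  apply/subspace_continuousP => v fv; apply/cvgrPdist_le => eps eps0.
  (* The radius offsets the Lipschitz constant [n]. *)
  have d0 : 0 < eps / n%:R by rewrite divr_gt0 ?ltr0n.
  rewrite near_withinE; apply: filterS (nbhsx_ballx v _ d0) => w [_ bvw] fw.
  have vw i j : `|vec_mx v i j - vec_mx w i j| <= eps / n%:R.
    by rewrite !mxE ltW //; apply: (bvw 0).
  have nd : n%:R * (eps / n%:R) = eps :> R.
    by rewrite mulrC divfK // pnatr_eq0 -lt0n.
  rewrite ler_distl; apply/andP; split.
    by rewrite lerBlDr -nd; apply: slem_lipschitz => // i j; rewrite distrC.
  by rewrite -nd; apply: slem_lipschitz.
have [v vfeas vmin] := compact_EVT_min ne compact_feasible_vec cont.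
exists (vec_mx v); split; first by rewrite inE in vfeas.
move=> Q feasQ; have := vmin (mxvec Q); rewrite mxvecK; apply.
by rewrite inE /feasible_vec /= mxvecK.
Qed.

End Minimizer.

Theorem corollary2p2 (R : realType) (n : nat) (e : rel 'I_n)
    (e_sym : symmetric e) (e_irr : irreflexive e)
    (e_conn : connected_graph e) :
  exists P : 'M[R]_n,
    fmmc_optimal e P /\
    (size (edge_probabilities e P) <= #|edge_orbits e|)%N.
Proof.
(* The characterization of [slem] needs a vertex. For [n = 0] there is only the empty matrix and no
   edge. *)
have [n0|n0] := posnP n.
  subst n; exists 0; split.
    split=> [|Q _]; last by rewrite (flatmx0 Q).
    split; try by case.
    - by apply/colP; case.
    - by rewrite trmx0.
  apply: leq_trans (size_undup _) _.
  by rewrite size_image (eq_card0 (_ : _ =i pred0)) // => -[[]].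
have [P [feasP minP]] := fmmc_optimal_exists R e n0.
have feasA := aut_average_feasible feasP.
exists (aut_average e P); split.
  split=> // Q feasQ.
  exact: le_trans (aut_average_slem n0 feasP) (minP Q feasQ).
apply: edge_probabilities_invariant => [i j|s i j].
  exact: feasible_sym feasA.
exact: aut_average_invariant.
Qed.
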